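(* There is a deterministic dynamical system $(U,T)$ such that: (1) $(U,T)$ is, up to isomorphism, the unique system in $\mathsf{DS}^{\mathsf{ef}}(\mathsf{SFT})$ that is $\mathsf{DS}^{\mathsf{ef}}(\mathsf{SFT})$-universal and $\mathsf{SFT}$-homogeneous; and (2) $(U,T)$ is, up to isomorphism, the unique system in $\mathsf{DS}^{\mathsf{ef}}(\mathsf{SOF})$ that is $\mathsf{DS}^{\mathsf{ef}}(\mathsf{SOF})$-universal and $\mathsf{SOF}$-homogeneous. Here $\mathsf{SFT}$ is the class of (nonempty) shifts of finite type and $\mathsf{SOF}$ the class of (nonempty) sofic shifts.
   Context: Deterministic systems. A deterministic (dynamical) system is a pair $(X,T)$ with $X$ a zero-dimensional, second-countable, compact Hausdorff space and $T:X\to X$ continuous. A factor $f:(Y,S)\to(X,T)$ is a continuous surjection with $f\circ S=T\circ f$. An embedding-factor pair (ef-pair) $(e,f):(X,T)\to(Y,S)$ consists of a factor $f:(Y,S)\to(X,T)$ together with the multifunction $e:x\mapsto f^{-1}(x)$ from $X$ to $Y$ (the embedding uniquely determined by $f$); composition is $(e',f')\circ(e,f)=(e'\circ e,f\circ f')$. $\mathsf{detSys}^{\mathsf{ef}}$ is the category of nonempty deterministic systems with ef-pairs as morphisms (so a morphism $(X,T)\to(Y,S)$ amounts to a factor $(Y,S)\to(X,T)$, and colimits of ef-pairs amount to limits of factors). Shifts. For a finite alphabet $A$, $A^\omega$ has the product of discrete topologies and $\sigma(x)_n=x_{n+1}$. A shift is a closed subset $X\subseteq A^\omega$ with $\sigma[X]\subseteq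 X$, regarded as the system $(X,\sigma)$. It is of finite type if there is a finite set $F$ of words over $A$ such that $X$ is the set of sequences in $A^\omega$ containing no word of $F$. It is sofic if it is a factor of a shift of finite type. For a collection $S$ of (nonempty) shifts, $\mathsf{DS}^{\mathsf{ef}}(S)$ is the full subcategory of $\mathsf{detSys}^{\mathsf{ef}}$ consisting of the objects that are colimits in $\mathsf{detSys}^{\mathsf{ef}}$ of $\omega$-chains $X_0\to X_1\to X_2\to\cdots$ of shifts in $S$. For a category $\mathsf{C}$ and a full subcategory $\mathsf{D}$, an object $U$ of $\mathsf{C}$ is $\mathsf{D}$-universal if for every object $A$ of $\mathsf{D}$ there is a morphism $A\to U$; it is $\mathsf{D}$-homogeneous if for every object $A$ of $\mathsf{D}$ and all morphisms $f,g:A\to U$ there is an isomorphism $h:U\to U$ with $h\circ g=f$. A class of shifts is identified with the full subcategory on it. *)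

(* Defs.v *)
From HB Require Import structures.
From mathcomp Require Import all_boot.
From mathcomp Require Import boolp classical_sets functions cardinality.
From mathcomp Require Import topology.

Set Implicit Arguments.
Unset Strict Implicit.
Unset Printing Implicit Defensive.

Local Open Scope classical_set_scope.

Record category := Category {
  obj :> Type;
  hom : obj -> obj -> Type;
  idm : forall a, hom a a;
  comp : forall a b c, hom b c -> hom a b -> hom a c;
  comp_assoc : forall a b c d (h : hom c d) (g : hom b c) (f : hom a b),
    comp h (comp g f) = comp (comp h g) f;
  comp_idl : forall a b (f : hom a b), comp (idm b) f = f;
  comp_idr : forall a b (f : hom a b), comp f (idm a) = f }.

Section CategoryNotions.
Variable C : category.

Definition is_iso (a b : C) (f : hom a b) : Prop :=
  exists g : hom b a, comp g f = idm a /\ comp f g = idm b.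

Definition isomorphic (a b : C) : Prop := exists f : hom a b, is_iso f.

Definition is_cocone (X : nat -> C) (phi : forall n, hom (X n) (X n.+1))
    (L : C) (c : forall n, hom (X n) L) : Prop :=
  forall n, comp (c n.+1) (phi n) = c n.

Definition is_colimit (X : nat -> C) (phi : forall n, hom (X n) (X n.+1))
    (L : C) (c : forall n, hom (X n) L) : Prop :=
  is_cocone phi c /\
  forall (M : C) (d : forall n, hom (X n) M), is_cocone phi d ->
    exists! u : hom L M, forall n, comp u (c n) = d n.

(* A full subcategory is given by the predicate selecting its objects. *)
Definition universal (D : C -> Prop) (U : C) : Prop :=
  forall A : C, D A -> inhabited (hom A U).

Definition homogeneous (D : C -> Prop) (U : C) : Prop :=
  forall A : C, D A -> forall f g : hom A U,
    exists h : hom U U, is_iso h /\ comp h g = f.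

Definition unique_up_to_iso (P : C -> Prop) (U : C) : Prop :=
  P U /\ forall V : C, P V -> isomorphic V U.

End CategoryNotions.

(* The usual zero-dimensionality. [zero_dimensional] of the library only asks
   that clopen sets separate points, which agrees with it on compact Hausdorff
   spaces. *)
Definition has_clopen_basis (T : topologicalType) : Prop :=
  exists2 B : set (set T), B `<=` clopen & basis B.

Record detSys := DetSys {
  space :> topologicalType;
  dyn : space -> space;
  dyn_continuous : continuous dyn;
  space_zero_dim : has_clopen_basis space;
  space_second_countable : @second_countable space;
  space_compact : compact [set: space];
  space_hausdorff : hausdorff_space space;
  space_nonempty : [set: space] !=set0 }.

Record is_factor (Y X : detSys) (f : Y -> X) : Prop := IsFactor {
  factor_continuous : continuous f;
  factor_surj : forall x : X, exists y : Y, f y = x;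
  factor_comm : forall y : Y, f (dyn y) = dyn (f y) }.

Record efPair (X Y : detSys) := EfPair {
  ef_emb : X -> set Y;
  ef_fac : Y -> X;
  ef_facP : is_factor ef_fac;
  ef_embE : forall x, ef_emb x = ef_fac @^-1` [set x] }.

Lemma efPair_eq (X Y : detSys) (p q : efPair X Y) :
  ef_fac p = ef_fac q -> p = q.
Proof.
case: p q => [e f fP eE] [e' f' f'P e'E] /= ff'.
move: f'P e'E; rewrite -ff' => f'P e'E.
have ee' : e = e' by apply/funext => x; rewrite eE e'E.
move: e'E; rewrite -ee' => e'E.
by rewrite (Prop_irrelevance fP f'P) (Prop_irrelevance eE e'E).
Qed.

Lemma is_factor_id (X : detSys) : is_factor (@idfun X).
Proof. by split=> // [x|x]; [exact: cvg_id | exists x]. Qed.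

Lemma is_factor_comp (X Y Z : detSys) (f : Y -> X) (g : Z -> Y) :
  is_factor f -> is_factor g -> is_factor (f \o g).
Proof.
move=> [cf sf mf] [cg sg mg]; split.
- by move=> z; apply: continuous_comp; [exact: cg | exact: cf].
- move=> x; have [y <-] := sf x; have [z <-] := sg y; by exists z.
- by move=> z /=; rewrite mg mf.
Qed.

Definition ef_id (X : detSys) : efPair X X :=
  @EfPair X X (fun x => [set x]) idfun (is_factor_id X) (fun=> erefl).

Lemma ef_comp_embE (X Y Z : detSys) (q : efPair Y Z) (p : efPair X Y) x :
  \bigcup_(y in ef_emb p x) ef_emb q y = (ef_fac p \o ef_fac q) @^-1` [set x].
Proof.
apply/seteqP; split=> [z [y]|z /= pqz].
  by rewrite !ef_embE /= => <- <-.
by exists (ef_fac q z); rewrite !ef_embE.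
Qed.

Definition ef_comp (X Y Z : detSys) (q : efPair Y Z) (p : efPair X Y) :
    efPair X Z :=
  @EfPair X Z (fun x => \bigcup_(y in ef_emb p x) ef_emb q y)
    (ef_fac p \o ef_fac q) (is_factor_comp (ef_facP p) (ef_facP q))
    (ef_comp_embE q p).

Definition detSys_ef : category.
Proof.
by refine (@Category detSys efPair ef_id ef_comp _ _ _) => *; apply: efPair_eq.
Defined.

Definition streams (A : finType) : Type :=
  prod_topology (fun _ : nat => discrete_topology A).

HB.instance Definition _ (A : finType) := Topological.copy (streams A)
  (prod_topology (fun _ : nat => discrete_topology A)).

Definition sigma (A : finType) (x : streams A) : streams A := fun n => x n.+1.

Section Streams.
Variable A : finType.
Implicit Types (x y : streams A) (U : set (streams A)).

Lemma coord_continuous n : continuous (fun x => x n : discrete_topology A).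
Proof. exact: (@proj_continuous nat (fun=> discrete_topology A) n). Qed.

Definition cylinder (w : seq A) : set (streams A) :=
  [set x | mkseq x (size w) = w].

Lemma mem_cylinder x n : cylinder (mkseq x n) x.
Proof. by rewrite /cylinder /= size_mkseq. Qed.

Lemma cylinderP x n y :
  cylinder (mkseq x n) y <-> forall i, (i < n)%N -> y i = x i.
Proof.
rewrite /cylinder /= size_mkseq; split=> [yx i ltin|yx].
  by have := congr1 (fun s => nth (x i) s i) yx; rewrite !nth_mkseq.
apply: (@eq_from_nth _ (x 0)) => [|i]; rewrite !size_mkseq// => ltin.
by rewrite !nth_mkseq// yx.
Qed.

Lemma nbhs_cylinder x n : nbhs x (cylinder (mkseq x n)).
Proof.
elim: n => [|n IHn].
  by apply: filterS filterT => y _; exact/cylinderP.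
have xn : nbhs x [set y | y n = x n].
  apply: (@coord_continuous n x [set x n]).
  exact: (discrete_set1 (X := discrete_topology A)).
apply: filterS (filterI IHn xn) => y [/cylinderP yx yn].
by apply/cylinderP => i; rewrite ltnS leq_eqVlt => /orP[/eqP->//|]; exact: yx.
Qed.

Lemma nbhs_streams x U : nbhs x U -> exists n, cylinder (mkseq x n) `<=` U.
Proof.
pose F := filter_from [set: nat] (fun n => cylinder (mkseq x n)).
have FF : Filter F.
  apply: filter_from_filter => [|i j _ _]; first by exists 0.
  exists (maxn i j) => // y /cylinderP yx.
  by split; apply/cylinderP => k lek; apply: yx; rewrite leq_max lek ?orbT.
suff: F --> x by move=> Fx /Fx [n _ sub]; exists n.
apply/cvg_sup => i; move=> V [W [[B oB <-] Bx] BV].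
exists i.+1 => // y /cylinderP yx; apply: BV.
by rewrite /preimage /= yx.
Qed.

Lemma cylinder_clopen w : clopen (cylinder w).
Proof.
split.
  rewrite openE => x wx; rewrite /interior.
  by rewrite -[w]wx; exact: nbhs_cylinder.
move=> x clx; have [y [wy /cylinderP yx]] := clx _ (nbhs_cylinder x (size w)).
rewrite /cylinder /= -[RHS]wy; apply: (@eq_from_nth _ (x 0)) => [|i].
  by rewrite !size_mkseq.
by rewrite size_mkseq => lti; rewrite !nth_mkseq// yx.
Qed.

Lemma streams_compact : compact [set: streams A].
Proof.
have cA : compact [set: discrete_topology A].
  by apply: finite_compact; exact: (@finite_finset A).
have := @tychonoff _ (fun _ : nat => discrete_topology A) (fun=> setT)
  (fun=> cA).
by congr (compact _); apply/seteqP; split.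
Qed.

Lemma streams_hausdorff : hausdorff_space (streams A).
Proof. by apply: hausdorff_product => ?; exact: discrete_hausdorff. Qed.

Lemma sigma_continuous : continuous (@sigma A).
Proof.
move=> x U /nbhs_streams[n nU]; apply: filterS (nbhs_cylinder x n.+1).
move=> y /cylinderP yx; apply: nU; apply/cylinderP => i lti; exact: yx.
Qed.

End Streams.

(* The nonempty shifts. *)
Record shift_space := Shift {
  alphabet : finType;
  points : set (streams alphabet);
  points_closed : closed points;
  points_sigma : @sigma alphabet @` points `<=` points;
  points_nonempty : points !=set0 }.

Arguments points : clear implicits.

Section ShiftSystem.
Variable X : shift_space.
Local Notation P := (set_type (points X)).

Lemma shift_dyn_subproof (x : P) : sigma (set_val x) \in points X.
Proof.
by apply/mem_set/points_sigma; exists (set_val x) => //; exact: set_valP.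
Qed.

Definition shift_dyn (x : P) : P :=
  exist _ (sigma (set_val x)) (shift_dyn_subproof x).

Lemma set_val_continuous : continuous (set_val : P -> streams (alphabet X)).
Proof. exact: initial_continuous. Qed.

Lemma shift_dyn_continuous : continuous shift_dyn.
Proof.
move=> x V [W [[B oB <-] Bx] BV].
have sB : nbhs (sigma (set_val x)) B by exact: open_nbhs_nbhs.
have: nbhs x (set_val @^-1` (@sigma _ @^-1` B)).
  exact: set_val_continuous (sigma_continuous sB).
by apply: filterS => y /= By; apply: BV.
Qed.

Definition shift_cylinders : set (set P) :=
  [set set_val @^-1` (cylinder w) | w in [set: seq (alphabet X)]].

Lemma shift_cylinders_clopen : shift_cylinders `<=` clopen.
Proof.
move=> _ [w _ <-]; apply: preimage_clopen; first exact: cylinder_clopen.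
exact: set_val_continuous.
Qed.

Lemma shift_cylinders_basis : basis shift_cylinders.
Proof.
split=> [U /shift_cylinders_clopen[]//|x V [W [[B oB <-] Bx] BV]].
have /nbhs_streams[n nB] : nbhs (set_val x) B by exact: open_nbhs_nbhs.
exists (set_val @^-1` (cylinder (mkseq (set_val x) n))).
  by split; [exists (mkseq (set_val x) n) | exact: mem_cylinder].
by move=> y /nB By; exact: BV.
Qed.

Lemma shift_cylinders_countable : countable shift_cylinders.
Proof. exact: sub_countable (card_image_le _ _) (countableP _). Qed.

Lemma shift_compact : compact [set: P].
Proof.
have cX : compact (points X).
  apply: (subclosed_compact _ (@streams_compact _)) => //.
  exact: points_closed.
move=> F FF _.
have [|x [Xx clx]] := cX (set_val @ F) _.
  by apply: (@filterS _ F _ setT) => [y _|]; [exact: set_valP | exact: filterT].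
exists (exist _ x (mem_set Xx) : P); split=> // U V FU [W [[B oB <-] Bx] BV].
have [||y [[z Uz <-] By]] := clx (set_val @` U) B.
- by apply: (@filterS _ F _ U) => [z Uz|]; [exists z | exact: FU].
- exact: open_nbhs_nbhs.
by exists z; split=> //; exact: BV.
Qed.

Lemma shift_hausdorff : hausdorff_space P.
Proof.
move=> x y clxy; apply: val_inj; apply: streams_hausdorff => U V Ux Vy.
have [z [Uz Vz]] := clxy _ _ (set_val_continuous Ux) (set_val_continuous Vy).
by exists (set_val z).
Qed.

Lemma shift_nonempty : [set: P] !=set0.
Proof.
by have [x Xx] := points_nonempty X; exists (exist _ x (mem_set Xx) : P).
Qed.

Lemma shift_zero_dim : has_clopen_basis P.
Proof.
by exists shift_cylinders;
  [exact: shift_cylinders_clopen | exact: shift_cylinders_basis].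
Qed.

Lemma shift_second_countable : @second_countable P.
Proof.
by exists shift_cylinders;
  [exact: shift_cylinders_countable | exact: shift_cylinders_basis].
Qed.

Definition shift_sys : detSys := DetSys shift_dyn_continuous shift_zero_dim
  shift_second_countable shift_compact shift_hausdorff shift_nonempty.

End ShiftSystem.

Coercion shift_sys : shift_space >-> detSys.

Definition occurs (A : finType) (w : seq A) (x : streams A) : Prop :=
  exists i, mkseq (fun k => x (i + k)) (size w) = w.

Definition SFT (X : shift_space) : Prop :=
  exists F : seq (seq (alphabet X)),
    points X = [set x | forall w, w \in F -> ~ occurs w x].

Definition SOF (X : shift_space) : Prop :=
  exists Y : shift_space, SFT Y /\ exists f : Y -> X, is_factor f.

(* A class of shifts, as a full subcategory of [detSys_ef]. *)
Definition shift_objects (S : shift_space -> Prop) : detSys_ef -> Prop :=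
  fun A => exists X : shift_space, S X /\ A = shift_sys X.

Definition DS (S : shift_space -> Prop) : detSys_ef -> Prop :=
  fun L => exists (X : nat -> detSys_ef)
      (phi : forall n, hom (X n) (X n.+1)) (c : forall n, hom (X n) L),
    (forall n, shift_objects S (X n)) /\ is_colimit phi c.

(* Main.v *)
(* Every system in DS(S) is the inverse limit of its projections to shifts of S,
   and a factor from it onto a shift depends on one projection only, since the
   0-th coordinate is locally constant. Hence any two systems U, V in DS(S)
   through which factors onto shifts of S lift (given U -> X and Y -> X there is
   U -> Y over X) are isomorphic over a common shift, by back-and-forth; this
   lifting property follows from universality and homogeneity, and conversely
   implies both.
   Shifts of finite type have pullbacks over arbitrary shifts, because agreement
   of two block codes is a condition on finite windows, and each one has, up to
   isomorphism, countably many extensions of finite type. So there is a sequence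
   of shifts of finite type absorbing all extensions of its members. Its limit
   has the lifting property for sofic shifts too: a sofic Y -> X is covered by a
   shift of finite type Y' -> Y, and one pulls back along Y' -> X. *)
Require Import Defs.
From mathcomp Require Import all_boot.
From mathcomp Require Import boolp classical_sets functions cardinality.
From mathcomp Require Import topology.

Set Implicit Arguments.
Unset Strict Implicit.
Unset Printing Implicit Defensive.

Local Open Scope classical_set_scope.

(** * Compact spaces *)

Lemma compact_decreasing (T : topologicalType) (C : nat -> set T) :
  compact [set: T] -> (forall n, closed (C n)) ->
  (forall n, C n.+1 `<=` C n) -> (forall n, C n !=set0) ->
  exists x, forall n, C n x.
Proof.
move=> cT clC decC C0.
have mono m n : (m <= n)%N -> C n `<=` C m.
  elim: n => [|n IHn]; first by rewrite leqn0 => /eqP->.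
  by rewrite leq_eqVlt => /predU1P[->//|/IHn]; apply: subset_trans.
pose F := filter_from [set: nat] C.
have FF : ProperFilter F.
  apply: filter_from_proper => [|n _]; last exact: C0.
  apply: filter_from_filter => [|i j _ _]; first by exists 0.
  exists (maxn i j) => // x Cx.
  by split; apply: mono Cx; rewrite ?leq_maxl ?leq_maxr.
have [|x [_ Fx]] := cT F FF; first by exists 0.
exists x => n; apply: (clC n) => B xB.
by apply: Fx => //; exists n.
Qed.

Lemma closed_equalizer (U X : topologicalType) (f g : U -> X) :
  continuous f -> continuous g -> hausdorff_space X ->
  closed [set u | f u = g u].
Proof.
move=> cf cg hX u clu; apply: hX => A B fA gB.
have uAB : nbhs u (f @^-1` A `&` g @^-1` B).
  by apply: filterI; [exact: cf | exact: cg].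
have [v [/= fg [Av Bv]]] := clu _ uAB.
by exists (f v); split=> //; rewrite fg.
Qed.

(* A map into a compact space that is continuous after composition with a
   separating family is continuous: every cluster point of [r] at [x] is sent
   by the whole family to the image of [r x]. *)
Lemma continuous_separating (T U : topologicalType) (I : Type)
    (Z : I -> topologicalType) (f : forall i, U -> Z i) (r : T -> U) :
  compact [set: U] -> (forall i, hausdorff_space (Z i)) ->
  (forall i, continuous (f i)) -> (forall i, continuous (f i \o r)) ->
  (forall u u', (forall i, f i u = f i u') -> u = u') -> continuous r.
Proof.
move=> cU hZ cf cfr sep x V; rewrite nbhs_filterE nbhsE => -[O [oO Ox] OV].
apply: contrapT => nV.
pose F := r @ within (~` (r @^-1` V)) (nbhs x).
have FF : ProperFilter F.
  apply: fmap_proper_filter; split; last exact: within_filter.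
  move=> n0; apply: nV; move: n0; rewrite /within /=.
  by apply: filterS => y /= h; apply: contrapT.
have [|u [_ clu]] := cU F FF; first exact: filterT.
have ru : u = r x.
  apply: sep => i; apply: (hZ i) => A B fA rB.
  pose P := [set y | B (f i (r y)) /\ ~ V (r y)].
  have FP : F (r @` P).
    have Bx : nbhs x [set y | B (f i (r y))] by exact: cfr rB.
    by apply: filterS Bx => y By nVy; exists y.
  have [_ [[y [By _] <-] Ay]] := clu _ (f i @^-1` A) FP (cf i _ _ fA).
  by exists (f i (r y)).
have FO : F (~` O).
  apply: (@filterS _ (nbhs x) _ setT) filterT => y _ nVy Oy.
  by apply: nVy; apply: OV.
have [|z []//] := clu _ O FO.
by rewrite ru; exact: open_nbhs_nbhs.
Qed.

(** The [p]-preimage of a closed set is the [q]-image of its compact [f]-preimage, hence closed. *)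
Lemma continuous_quotient (U Y X : topologicalType) (q : U -> Y) (f : U -> X)
    (p : Y -> X) :
  compact [set: U] -> hausdorff_space Y -> continuous q -> continuous f ->
  (forall y, exists u, q u = y) -> (forall u, p (q u) = f u) -> continuous p.
Proof.
move=> cU hY cq cf sq pq; apply/continuous_closedP => C clC.
have -> : p @^-1` C = q @` (f @^-1` C).
  apply/seteqP; split=> [y|_ [u Cu <-]] /=; last by rewrite pq.
  by have [u <-] := sq y; rewrite pq => Cu; exists u.
apply: compact_closed => //; apply: continuous_compact.
  exact: continuous_subspaceT.
apply: subclosed_compact cU _ => //.
by move/continuous_closedP : cf; apply.
Qed.

(** The basis consists of the finite intersections of sets [D i] and their complements. If no such
    set around [x] fits in an open [O], compactness gives a point outside [O] that lies in all of
    them, and separation identifies it with [x]. *)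
Lemma clopen_separating_basis (T : topologicalType) (I : countType)
    (D : I -> set T) :
  compact [set: T] -> (forall i, clopen (D i)) ->
  (forall x y, (forall i, D i x -> D i y) -> x = y) ->
  exists B : set (set T), [/\ countable B, B `<=` clopen & basis B].
Proof.
move=> cT clD sep.
pose fix C (l : seq (I * bool)) : set T := if l is (i, b) :: l' then
  (if b then D i else ~` D i) `&` C l' else setT.
have Ccl l : clopen (C l).
  elim: l => [|[i [] l IHl]] /=; first by split; [exact: openT|exact: closedT].
    exact: clopenI.
  apply: clopenI => //; exact: (@clopenC _ (D i) setT).
have Ccat l l' : C (l ++ l') = C l `&` C l'.
  by elim: l => [|[i b] l IHl] /=; rewrite ?setTI// IHl setIA.
exists (range C); split.
- exact: sub_countable (card_image_le _ _) (countableP _).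
- by move=> _ [l _ <-].
split=> [_ [l _ <-]|x V]; first by have [] := Ccl l.
rewrite nbhs_filterE nbhsE => -[O [oO Ox] OV].
apply: contrapT => nC.
pose F := filter_from [set l | C l x] (fun l => C l `&` ~` O).
have FF : ProperFilter F.
  apply: filter_from_proper => [|l Cx]; last first.
    apply: contrapT => /set0P /negP; rewrite negbK => /eqP C0; apply: nC.
    exists (C l) => [|y Cy]; first by split; [exists l|exact: Cx].
    apply: OV; apply: contrapT => nOy.
    by have : (set0 : set T) y by rewrite -C0; split.
  apply: filter_from_filter => [|i j Ci Cj]; first by exists [::].
  exists (i ++ j); first by rewrite /= Ccat.
  by rewrite Ccat => y [[Ciy Cjy] nO].
have [|y [_ Fy]] := cT F FF; first by exists [::].
have nOy : (~` O) y.
  apply: (open_closedC oO) => A /Fy; apply.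
  by exists [::] => // z [].
have Cy l : C l x -> C l y.
  move=> Cx; apply: (proj2 (Ccl l)) => A /Fy; apply.
  by exists l => // z [].
apply: nOy; suff <- : x = y by [].
apply: sep => i Dx.
by have [|//] := Cy [:: (i, true)]; split.
Qed.

(** * Shifts and block codes *)

Definition coord (X : shift_space) (x : X) (i : nat) : alphabet X :=
  set_val (x : set_type (points X)) i.

Lemma coordP (X : shift_space) (x : X) : points X (coord x).
Proof. exact: (@set_valP _ (points X) x). Qed.

Lemma coord_inj (X : shift_space) (x y : X) :
  (forall i, coord x i = coord y i) -> x = y.
Proof. by move=> xy; apply: val_inj; apply/funext => i; exact: xy. Qed.

Lemma coord_surj (X : shift_space) (s : streams (alphabet X)) :
  points X s -> exists x : X, forall i, coord x i = s i.
Proof. by move=> Xs; exists (exist _ s (mem_set Xs)). Qed.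

Lemma coord_dyn (X : shift_space) (x : X) i : coord (dyn x) i = coord x i.+1.
Proof. by []. Qed.

Lemma coord_iter (X : shift_space) (x : X) i j :
  coord (iter i (@dyn X) x) j = coord x (i + j).
Proof. by elim: i j => //= i IHi j; rewrite addSnnS -IHi. Qed.

Lemma nbhs_coord (X : shift_space) (x : X) n :
  nbhs x [set y : X | forall i, (i < n)%N -> coord y i = coord x i].
Proof.
have : nbhs x (set_val @^-1` cylinder (mkseq (set_val x) n)).
  exact: set_val_continuous (nbhs_cylinder (set_val x) n).
by apply: filterS => y /cylinderP yx i lti; exact: yx.
Qed.

Lemma nbhs_coordP (X : shift_space) (x : X) (V : set X) : nbhs x V ->
  exists n, forall y : X, (forall i, (i < n)%N -> coord y i = coord x i) -> V y.
Proof.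
move=> [W [[B oB <-] Bx] BV].
have /nbhs_streams[n nB] : nbhs (set_val x) B by exact: open_nbhs_nbhs.
by exists n => y yx; apply: BV; apply: nB; apply/cylinderP.
Qed.

(** Otherwise the pairs in [E n] with distinct [k]-values form decreasing nonempty closed sets,
    closed because [k] is locally constant, and a common point contradicts the last hypothesis. This
    gives both the windows of block codes and the stage through which a factor passes. *)
Lemma compact_uniform (U : topologicalType) (A : Type) (k : U -> A)
    (E : nat -> set (U * U)) :
  compact [set: U] -> (forall u, nbhs u [set v | k v = k u]) ->
  (forall n, closed (E n)) -> (forall n, E n.+1 `<=` E n) ->
  (forall u v, (forall n, E n (u, v)) -> k u = k v) ->
  exists n, forall u v, E n (u, v) -> k u = k v.
Proof.
move=> cU lk clE decE Ek; apply: contrapT => nE.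
have cUU : compact [set: U * U].
  by rewrite -setXTT; exact: compact_setX.
have [||n|[u v] Cuv] :=
  @compact_decreasing _ (fun n => E n `&` [set z | k z.1 <> k z.2]) cUU.
- move=> n; apply: closedI => // -[u v] cl /= kuv.
  have [|[u' v'] [/= nk [ku kv]]] :=
      cl ([set w | k w = k u] `*` [set w | k w = k v]).
    by exists ([set w | k w = k u], [set w | k w = k v]) => //.
  by apply: nk; rewrite ku kv.
- by move=> n z [/decE].
- apply: contrapT => C0; apply: nE; exists n => u v Euv.
  by apply: contrapT => kuv; apply: C0; exists (u, v).
- have [_] := Cuv 0; apply; apply: Ek => n.
  by have [] := Cuv n.
Qed.

(** The window of the Curtis-Hedlund-Lyndon theorem: [compact_uniform] for agreement on the first
    [n] coordinates. *)
Lemma local_code (X Y : shift_space) (h : Y -> X) : continuous h ->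
  exists n, forall y z, (forall i, (i < n)%N -> coord y i = coord z i) ->
    coord (h y) 0 = coord (h z) 0.
Proof.
move=> ch.
pose E n := [set z : Y * Y | forall i, (i < n)%N -> coord z.1 i = coord z.2 i].
have [|||||n nE] := @compact_uniform Y _ (fun y => coord (h y) 0) E.
- exact: space_compact.
- move=> y; have : nbhs y (h @^-1` [set x | forall i, (i < 1)%N ->
      coord x i = coord (h y) i]) by exact: ch y _ (nbhs_coord (h y) 1).
  by apply: filterS => z /= /(_ 0 isT).
- move=> n [y z] cl i lti /=.
  have [|[y' z'] [/= /(_ _ lti) yz' [yy' zz']]] := cl
      ([set w | forall i, (i < n)%N -> coord w i = coord y i] `*`
       [set w | forall i, (i < n)%N -> coord w i = coord z i]).
    exists ([set w | forall i, (i < n)%N -> coord w i = coord y i],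
      [set w | forall i, (i < n)%N -> coord w i = coord z i]) => //.
    by split; exact: nbhs_coord.
  by rewrite -yy'// -zz'.
- by move=> n z Ez i lti; apply: Ez; exact: ltnW.
- move=> y z Eyz; congr (coord (h _) 0); apply: coord_inj => i.
  exact: (Eyz i.+1).
- by exists n => y z yz; exact: nE.
Qed.

(** Equivariance carries local constancy from coordinate 0 to all others: coordinate [i.+1] of [h m]
    is coordinate [i] of [h (dyn m)]. *)
Lemma continuous_to_shift (M : detSys) (X : shift_space) (h : M -> X) :
  (forall m, h (dyn m) = dyn (h m)) ->
  (forall m, nbhs m [set m' | coord (h m') 0 = coord (h m) 0]) -> continuous h.
Proof.
move=> eh lh.
have li i : forall m, nbhs m [set m' | coord (h m') i = coord (h m) i].
  elim: i => // i IHi m.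
  have : nbhs m (@dyn M @^-1`
      [set m' | coord (h m') i = coord (h (dyn m)) i]).
    exact: dyn_continuous (IHi (dyn m)).
  by apply: filterS => m' /=; rewrite !eh.
move=> m V /nbhs_coordP[n nV].
have : nbhs m [set m' | forall i, (i < n)%N -> coord (h m') i = coord (h m) i].
  elim: n {nV} => [|n IHn]; first by apply: filterS filterT.
  apply: filterS (filterI IHn (li n m)) => m' [IH hn] i.
  by rewrite ltnS leq_eqVlt => /predU1P[->//|]; exact: IH.
by apply: filterS => m' /nV.
Qed.

Lemma continuous_code (X Y : shift_space) (h : Y -> X) n :
  (forall y, h (dyn y) = dyn (h y)) ->
  (forall y z, (forall i, (i < n)%N -> coord y i = coord z i) ->
    coord (h y) 0 = coord (h z) 0) -> continuous h.
Proof.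
move=> eh nh; apply: continuous_to_shift => // y.
by apply: filterS (nbhs_coord y n) => z /nh.
Qed.

Lemma coord_factor (X : shift_space) (Y : detSys) (h : Y -> X) (y : Y) i :
  (forall y, h (dyn y) = dyn (h y)) ->
  coord (h y) i = coord (h (iter i (@dyn Y) y)) 0.
Proof.
move=> eh; have -> : h (iter i (@dyn Y) y) = iter i (@dyn X) (h y).
  by elim: i => //= i <-; rewrite eh.
by rewrite coord_iter addn0.
Qed.

(** Finite type without a list of words: membership is decided by windows of one fixed length. For
    shift-invariant sets this amounts to avoiding finitely many words, and it is easier to check for
    pullbacks and graphs. *)
Definition finite_type (A : finType) (P : set (streams A)) : Prop :=
  exists n, forall x : streams A,
    (forall i, exists2 y : streams A, P y &
      forall j, (j < n)%N -> y j = x (i + j)) -> P x.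

Definition avoiding (A : finType) (F : seq (seq A)) : set (streams A) :=
  [set x | forall w, w \in F -> ~ occurs w x].

Lemma avoiding_finite_type (A : finType) (F : seq (seq A)) :
  finite_type (avoiding F).
Proof.
(* With the longest forbidden length as window, every occurrence fits in one window. *)
exists (\max_(w <- F) size w) => x xF w wF [i iw].
have [y yF yx] := xF i; apply: (yF w wF); exists 0.
rewrite -[RHS]iw; apply: (@eq_from_nth _ (x 0)); rewrite !size_mkseq// => j ltj.
rewrite !nth_mkseq// add0n yx// (leq_trans ltj)//.
by rewrite (big_rem w)//= leq_maxl.
Qed.

Lemma finite_type_avoiding (A : finType) (P : set (streams A)) :
  finite_type P -> @sigma A @` P `<=` P -> exists F, P = avoiding F.
Proof.
move=> [n nP] sP.
have itP x i : P x -> P (fun k => x (i + k)).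
  elim: i x => // i IHi x Px.
  by apply: (IHi (sigma x)); apply: sP; exists x.
(* The forbidden words are those of length [n] that begin no point of [P]. *)
exists [seq val w | w <- enum {: n.-tuple A} &
          ~~ `[< exists2 x : streams A, P x & mkseq x n = val w >] ].
apply/seteqP; split=> [x Px w /mapP[t]|x xF].
  rewrite mem_filter => /andP[/asboolP nt _ -> [i iw]]; apply: nt.
  by exists (fun k => x (i + k)); [exact: itP | rewrite -iw size_tuple].
apply: nP => i; apply: contrapT => nx.
have st : size (mkseq (fun k => x (i + k)) n) == n by rewrite size_mkseq.
apply: (xF (mkseq (fun k => x (i + k)) n)); last first.
  by exists i; rewrite size_mkseq.
apply/mapP; exists (Tuple st) => //; rewrite mem_filter mem_enum andbT.
apply/asboolP => -[y Py yx]; apply: nx; exists y => // j ltj.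
by have := congr1 (fun s => nth (x 0) s j) yx; rewrite !nth_mkseq.
Qed.

Lemma finite_type_closed (A : finType) (P : set (streams A)) :
  finite_type P -> @sigma A @` P `<=` P -> closed P.
Proof.
move=> [n nP] sP x clx; apply: nP => i.
have [y [Py /cylinderP yx]] := clx _ (nbhs_cylinder x (i + n)).
exists (fun k => y (i + k)) => [|j ltj]; last by rewrite yx// ltn_add2l.
elim: i y {yx} Py => // i IHi y Py.
by apply: (IHi (sigma y)); apply: sP; exists y.
Qed.

Lemma SFTP (X : shift_space) : SFT X <-> finite_type (points X).
Proof.
split=> [[F ->]|/finite_type_avoiding]; first exact: avoiding_finite_type.
by apply; exact: points_sigma.
Qed.

(** The fibre product is a set of sequences over the product alphabet. Surjectivity of each of [f],
    [g] makes the projection to the other side onto. *)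
Lemma SFT_pullback (X Y Z : shift_space) (f : Y -> X) (g : Z -> X) :
  SFT Y -> SFT Z -> is_factor f -> is_factor g ->
  exists W : shift_space, SFT W /\ exists (p : W -> Y) (q : W -> Z),
    [/\ is_factor p, is_factor q & forall w, f (p w) = g (q w)].
Proof.
move=> /SFTP[nY hY] /SFTP[nZ hZ] [cf sf ef] [cg sg eg].
have [nf hf] := local_code cf; have [ng hg] := local_code cg.
pose AB : finType := (alphabet Y * alphabet Z)%type.
pose P := [set s : streams AB | exists (y : Y) (z : Z),
  f y = g z /\ forall i, s i = (coord y i, coord z i)].
have ftP : finite_type P.
  (* [nY] and [nZ] place the two components in [Y] and [Z]; [nf] and [ng] let each coordinate of the
     equation [f y = g z] be read off one window. *)
  exists (maxn (maxn nY nZ) (maxn nf ng)) => s sP.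
  have [y yE] : exists y : Y, forall i, coord y i = (s i).1.
    apply: coord_surj; apply: hY => i.
    have [t [y [z [_ tE]]] ts] := sP i.
    exists (coord y) => [|j ltj]; first exact: coordP.
    by rewrite -ts ?tE// !leq_max ltj.
  have [z zE] : exists z : Z, forall i, coord z i = (s i).2.
    apply: coord_surj; apply: hZ => i.
    have [t [y' [z [_ tE]]] ts] := sP i.
    exists (coord z) => [|j ltj]; first exact: coordP.
    by rewrite -ts ?tE// !leq_max ltj orbT.
  exists y, z; split=> [|i]; last by rewrite yE zE; case: (s i).
  apply: coord_inj => i; rewrite coord_factor// [RHS]coord_factor//.
  have [t [y' [z' [fg tE]]] ts] := sP i.
  rewrite (hf _ y') => [|j ltj].
    rewrite fg; apply: hg => j ltj.
    by rewrite coord_iter zE -ts ?tE// !leq_max ltj !orbT.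
  by rewrite coord_iter yE -ts ?tE// !leq_max ltj !orbT.
have sP : @sigma AB @` P `<=` P.
  move=> _ [s [y [z [fg sE]]] <-]; exists (dyn y), (dyn z).
  by rewrite ef eg fg; split=> // i; rewrite /sigma sE.
have [y0 _] := space_nonempty Y; have [z0 gz0] := sg (f y0).
have P0 : P !=set0.
  by exists (fun i => (coord y0 i, coord z0 i)), y0, z0.
pose W := Shift (finite_type_closed ftP sP) sP P0.
have WP (w : W) : exists yz : Y * Z, f yz.1 = g yz.2 /\
    forall i, coord w i = (coord yz.1 i, coord yz.2 i).
  by have [y [z yzP]] := coordP w; exists (y, z).
have [pq pqP] := choice WP.
have WS y z : f y = g z -> exists w : W, pq w = (y, z).
  move=> fg; have Pyz : P (fun i => (coord y i, coord z i)) by exists y, z.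
  have [w wE] := @coord_surj W _ Pyz; exists w; have [_] := pqP w.
  case: (pq w) => y' z' /= pqE; congr (_, _); apply: coord_inj => i;
  by have := pqE i; rewrite wE => -[].
have [pE qE] : (forall w, (pq (dyn w)).1 = dyn (pq w).1) /\
    (forall w, (pq (dyn w)).2 = dyn (pq w).2).
  split=> w; apply: coord_inj => i; have [_ /(_ i)] := pqP (dyn w);
  by rewrite !coord_dyn; have [_ ->] := pqP w => -[].
exists W; split; first exact/SFTP.
exists (fun w => (pq w).1), (fun w => (pq w).2); split.
- split=> // [|y].
    apply: (@continuous_code _ _ _ 1) => // w w' /(_ 0 isT).
    by have [_ ->] := pqP w; have [_ ->] := pqP w' => -[].
  have [z gz] := sg (f y).
  by have [|w wE] := WS y z; [|exists w; rewrite wE].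
- split=> // [|z].
    apply: (@continuous_code _ _ _ 1) => // w w' /(_ 0 isT).
    by have [_ ->] := pqP w; have [_ ->] := pqP w' => -[].
  have [y fy] := sf (g z).
  by have [|w wE] := WS y z; [|exists w; rewrite wE].
- by move=> w; have [] := pqP w.
Qed.

(** * Extensions of finite type *)

Record sft_ext (X : shift_space) := SFTExt {
  ext_dom : shift_space;
  ext_sft : SFT ext_dom;
  ext_map : ext_dom -> X;
  ext_factor : is_factor ext_map }.

(* [(m, F)] encodes an extension [f : W -> X] when, after an injective renaming
   of the letters of [W] by numbers below [m], the graph of [f] is the shift
   avoiding [F]. *)
Definition encodes (X : shift_space)
    (c : {m : nat & seq (seq ('I_m * alphabet X))}) (E : sft_ext X) : Prop :=
  exists2 iota : alphabet (ext_dom E) -> 'I_(tag c), injective iota &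
    forall s : streams ('I_(tag c) * alphabet X)%type,
      avoiding (tagged c) s <-> exists w : ext_dom E, forall i,
        s i = (iota (coord w i), coord (ext_map w) i).

(** Letters are renamed by their rank; the graph has finite type because a block code determines its
    second component. *)
Lemma encodes_exists (X : shift_space) (E : sft_ext X) :
  exists c, encodes c E.
Proof.
case: E => W sW f fP; have [n hn] := (SFTP W).1 sW; have [cf _ ef] := fP.
have [nf hf] := local_code cf.
pose m := #|alphabet W|; pose AB : finType := ('I_m * alphabet X)%type.
pose Q := [set s : streams AB | exists w : W, forall i,
  s i = (enum_rank (coord w i), coord (f w) i)].
have ftQ : finite_type Q.
  (* Length at least 1 keeps position [i] inside its own window, where the second component is
     compared. *)
  exists (maxn 1 (maxn n nf)) => s sQ.
  have [w wE] : exists w : W, forall i, coord w i = enum_val (s i).1.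
    apply: (@coord_surj W (fun i => enum_val (s i).1)); apply: hn => i.
    have [t [w tE] ts] := sQ i.
    exists (coord w) => [|j ltj]; first exact: coordP.
    by rewrite -ts ?tE ?enum_rankK// !leq_max ltj orbT.
  exists w => i; rewrite wE enum_valK coord_factor//.
  have [t [w' tE] ts] := sQ i.
  rewrite (hf _ w') => [|j ltj].
    by have := ts 0; rewrite leq_max tE addn0 => <-.
  by rewrite coord_iter wE -ts ?tE ?enum_rankK// !leq_max ltj !orbT.
have sQ : @sigma AB @` Q `<=` Q.
  move=> _ [s [w sE] <-]; exists (dyn w) => i.
  by rewrite ef !coord_dyn /sigma sE.
have [F QF] := finite_type_avoiding ftQ sQ.
exists (Tagged (fun m => seq (seq ('I_m * alphabet X))) F).
exists (enum_rank : alphabet W -> 'I_m); first exact: enum_rank_inj.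
by rewrite /= -QF.
Qed.

(** Both graphs become the same set after renaming, so [r] merely relabels letters, by injectivity
    of the renamings. *)
Lemma encodes_dominated (X : shift_space) c (E E' : sft_ext X) :
  encodes c E -> encodes c E' ->
  exists2 r : ext_dom E -> ext_dom E', is_factor r &
    forall w, ext_map (r w) = ext_map w.
Proof.
move=> [k kI kE] [k' k'I k'E].
have rE (w : ext_dom E) : exists w' : ext_dom E', forall i,
    k (coord w i) = k' (coord w' i) /\
    coord (ext_map w) i = coord (ext_map w') i.
  have /k'E[w' ww'] : avoiding (tagged c)
      (fun i => (k (coord w i), coord (ext_map w) i)).
    by apply/kE; exists w.
  by exists w' => i; have [-> ->] := ww' i.
have [r rP] := choice rE.
exists r => [|w]; last by apply: coord_inj => i; have [] := rP w i.
have er w : r (dyn w) = dyn (r w).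
  apply: coord_inj => i; apply: k'I.
  by have [<- _] := rP (dyn w) i; have [<- _] := rP w i.+1.
split=> // [|w'].
  apply: (@continuous_code _ _ _ 1) => // w v /(_ 0 isT) wv; apply: k'I.
  by have [<- _] := rP w 0; have [<- _] := rP v 0; rewrite wv.
have /kE[w ww'] : avoiding (tagged c)
    (fun i => (k' (coord w' i), coord (ext_map w') i)).
  by apply/k'E; exists w'.
exists w; apply: coord_inj => i; apply: k'I.
by have [<- _] := rP w i; have [-> _] := ww' i.
Qed.

(** Codes form a countable type, and one extension is chosen for each; [E0] fills the indices that
    encode none. *)
Lemma sft_ext_enum (X : shift_space) (E0 : sft_ext X) :
  exists e : nat -> sft_ext X, forall E : sft_ext X,
    exists j, exists2 r : ext_dom (e j) -> ext_dom E, is_factor r &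
      forall w, ext_map (r w) = ext_map w.
Proof.
have codeP j : exists E : sft_ext X, forall c, unpickle j = Some c ->
    (exists E', encodes c E') -> encodes c E.
  case: (unpickle j) => [c|]; last by exists E0.
  have [[E cE]|ncE] := pselect (exists E' : sft_ext X, encodes c E').
    by exists E => _ [<-].
  by exists E0 => _ [<-] /ncE.
have [e eP] := choice codeP.
exists e => E; have [c cE] := encodes_exists E.
exists (pickle c); apply: (encodes_dominated _ cE).
apply: (eP (pickle c)); [exact: pickleK | by exists E].
Qed.

Definition sft_ext_id (X : shift_space) (sX : SFT X) : sft_ext X :=
  SFTExt sX (is_factor_id X).

Definition exts (X : shift_space) (sX : SFT X) : nat -> sft_ext X :=
  projT1 (cid (sft_ext_enum (sft_ext_id sX))).

Lemma exts_dominate (X : shift_space) (sX : SFT X) (E : sft_ext X) :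
  exists j, exists2 r : ext_dom (exts sX j) -> ext_dom E, is_factor r &
    forall w, ext_map (r w) = ext_map w.
Proof. exact: (projT2 (cid (sft_ext_enum (sft_ext_id sX)))). Qed.

Lemma sft_ext_pull (X : shift_space) (D E : sft_ext X) :
  exists E' : sft_ext (ext_dom D),
    exists2 r : ext_dom E' -> ext_dom E, is_factor r &
      forall w, ext_map (r w) = ext_map (ext_map w).
Proof.
have [W [sW [p [q [fp fq pq]]]]] :=
  SFT_pullback (ext_sft D) (ext_sft E) (ext_factor D) (ext_factor E).
by exists (SFTExt sW fp), q => // w; rewrite pq.
Qed.

Definition pull (X : shift_space) (D E : sft_ext X) : sft_ext (ext_dom D) :=
  projT1 (cid (sft_ext_pull D E)).

Lemma pullP (X : shift_space) (D E : sft_ext X) :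
  exists2 r : ext_dom (pull D E) -> ext_dom E, is_factor r &
    forall w, ext_map (r w) = ext_map (ext_map w).
Proof. exact: (projT2 (cid (sft_ext_pull D E))). Qed.

(** * The absorbing sequence of shifts of finite type *)

Lemma unit_streams_nonempty : [set: streams unit] !=set0.
Proof. by exists (fun=> tt). Qed.

Definition point_shift : shift_space :=
  Shift (@closedT (streams unit)) (fun _ _ => I) unit_streams_nonempty.

Lemma point_shift_SFT : SFT point_shift.
Proof. by exists [::]; apply/seteqP; split. Qed.

Lemma point_shift_terminal (X : detSys) :
  exists f : X -> point_shift, is_factor f.
Proof.
have [o oP] := @coord_surj point_shift (fun=> tt) I.
have oE (x y : point_shift) : x = y.
  by apply: coord_inj => i; case: (coord x i) (coord y i) => -[].
exists (fun=> o); split; first exact: cst_continuous.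
- by move=> x; have [y _] := space_nonempty X; exists y.
- by move=> y; exact: oE.
Qed.

(* Stage [n] of the construction carries, for each [i <= n] and [j], the [j]-th
   extension of the shift of stage [i], pulled back to stage [n]; the next stage
   is the domain of one of them. *)
Record stage := Stage {
  stage_shift : shift_space;
  stage_sft : SFT stage_shift;
  stage_ext : nat -> nat -> sft_ext stage_shift }.

(** The number [n] codes a list whose first two entries name the extension to be absorbed; missing
    entries read as 0. *)
Definition scheduled n (s : stage) : sft_ext (stage_shift s) :=
  stage_ext s (nth 0 (CodeSeq.decode n) 0) (nth 0 (CodeSeq.decode n) 1).

Definition next_stage n (s : stage) : stage :=
  Stage (ext_sft (scheduled n s)) (fun i j =>
    if i == n.+1 then exts (ext_sft (scheduled n s)) j
    else pull (scheduled n s) (stage_ext s i j)).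

Fixpoint stages n : stage :=
  if n is m.+1 then next_stage m (stages m)
  else Stage point_shift_SFT (fun=> exts point_shift_SFT).

Definition link n : stage_shift (stages n.+1) -> stage_shift (stages n) :=
  @ext_map _ (scheduled n (stages n)).

Definition coherent (X : nat -> shift_space) (p : forall n, X n.+1 -> X n)
  (x : forall n, X n) : Prop := forall n, p n (x n.+1) = x n.

(** The index [j] is found at stage [i] and survives every later pullback. Compatibility is stated
    along coherent sequences, which avoids composing the links from [n] down to [i]. *)
Lemma stage_ext_dominates i (E : sft_ext (stage_shift (stages i))) :
  exists j, forall n, (i <= n)%N ->
    exists2 r : ext_dom (stage_ext (stages n) i j) -> ext_dom E, is_factor r &
      forall x, coherent link x ->
        forall w, ext_map w = x n -> ext_map (r w) = x i.
Proof.
have [j [r0 fr0 r0P]] : exists j,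
    exists2 r : ext_dom (stage_ext (stages i) i j) -> ext_dom E, is_factor r &
      forall w, ext_map (r w) = ext_map w.
  case: i E => [|i] E; first exact: exts_dominate.
  by rewrite /= eqxx; exact: exts_dominate.
exists j; elim=> [|n IHn].
  rewrite leqn0 => /eqP i0; subst i.
  by exists r0 => // x _ w; rewrite r0P.
rewrite leq_eqVlt => /predU1P[ni|].
  subst i.
  by exists r0 => // x _ w; rewrite r0P.
rewrite ltnS => lein; have [r fr rP] := IHn lein.
rewrite /= ltn_eqF ?ltnS//.
have [q fq qP] := pullP (scheduled n (stages n)) (stage_ext (stages n) i j).
exists (r \o q); first exact: is_factor_comp.
move=> x cx w wx; apply: rP => //.
by rewrite qP wx; exact: cx.
Qed.

Lemma stages_absorb i (E : sft_ext (stage_shift (stages i))) :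
  exists n, exists2 r : stage_shift (stages n) -> ext_dom E, is_factor r &
    forall x, coherent link x -> ext_map (r (x n)) = x i.
Proof.
have [j jP] := stage_ext_dominates E.
(* At this step the chosen extension is scheduled. A code exceeds the entries of its list, so stage
   [i] has been reached by then. *)
pose n := CodeSeq.code [:: i; j].
have lein : (i <= n)%N.
  by have /= /andP[/ltnW] := CodeSeq.ltn_code [:: i; j].
have [r fr rP] := jP n lein.
have sE : scheduled n (stages n) = stage_ext (stages n) i j.
  by rewrite /scheduled /n CodeSeq.codeK.
rewrite -sE in r fr rP *.
exists n.+1, r => // x cx; apply: rP => //; exact: cx.
Qed.

(** * Inverse limits *)

Lemma compact_set_type (T : topologicalType) (K : set T) :
  compact K -> compact [set: set_type K].
Proof.
move=> cK F FF _.
have [|x [Kx clx]] := cK (set_val @ F) _.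
  by apply: (@filterS _ F _ setT) => [y _|]; [exact: set_valP | exact: filterT].
exists (exist _ x (mem_set Kx)); split=> // U V FU [W [[B oB <-] Bx] BV].
have [||y [[z Uz <-] By]] := clx (set_val @` U) B.
- by apply: (@filterS _ F _ U) => [z Uz|]; [exists z | exact: FU].
- exact: open_nbhs_nbhs.
by exists z; split=> //; exact: BV.
Qed.

(** From [X 0] one chooses preimages upwards; for larger [n] the first shift is dropped and its
    coordinate restored by [p 0]. *)
Lemma coherent_through (X : nat -> shift_space) (p : forall n, X n.+1 -> X n)
    n (a : X n) :
  (forall n, is_factor (p n)) -> exists2 x, coherent p x & x n = a.
Proof.
elim: n X p a => [|n IHn] X p a fp.
  have sp k (y : X k) : exists z, p k z = y by exact: (factor_surj (fp k)).
  pose s k (y : X k) := projT1 (cid (sp k y)).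
  exists (nat_rect X a s) => // k /=; exact: (projT2 (cid (sp k _))).
have [x cx xa] := IHn (X \o S) (fun k => p k.+1) a (fun k => fp k.+1).
exists (fun k => if k is k'.+1 then x k' else p 0 (x 0)) => // -[|k] //=.
exact: cx.
Qed.

(** An internal description of inverse limits: that every coherent sequence comes from a point of
    [L] follows by compactness from surjectivity of the [psi n]. *)
Definition presents (L : detSys) (X : nat -> shift_space)
    (p : forall n, X n.+1 -> X n) (psi : forall n, L -> X n) : Prop :=
  [/\ forall n, is_factor (p n), forall n, is_factor (psi n),
      forall u, coherent p (fun n => psi n u) &
      forall u v, (forall n, psi n u = psi n v) -> u = v].

Lemma inverse_limit (X : nat -> shift_space) (p : forall n, X n.+1 -> X n) :
  (forall n, is_factor (p n)) ->
  exists (L : detSys) (psi : forall n, L -> X n), presents p psi.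
Proof.
move=> fp.
pose T := prod_topology (fun n => X n : topologicalType).
have cT : compact [set: T].
  have := @tychonoff _ (fun n => X n : topologicalType) (fun=> setT)
    (fun n => space_compact (d := X n)).
  by congr (compact _); apply/seteqP; split.
have cpr n : continuous (fun x : T => x n).
  exact: (@proj_continuous nat (fun n => X n : topologicalType) n).
pose K := [set x : T | coherent p x].
have clK : closed K.
  move=> x clx n.
  have clE : closed [set y : T | p n (y n.+1) = y n].
    apply: closed_equalizer (cpr n) (@space_hausdorff (X n)) => y.
    apply: (@continuous_comp _ _ _ _ (p n) y (cpr n.+1 y)).
    exact: (factor_continuous (fp n)).
  by apply: clE; apply: closure_subset clx => y; exact.
have cL : compact [set: set_type K].
  by apply: compact_set_type; exact: subclosed_compact clK cT _.
pose pr n (x : set_type K) : X n := set_val x n.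
have pr_cont n : continuous (pr n).
  have sv : continuous (set_val : set_type K -> T) by exact: initial_continuous.
  by move=> x V xV; exact: (sv x _ (cpr n _ _ xV)).
have pr_inj x y : (forall n, pr n x = pr n y) -> x = y.
  move=> xy; apply: val_inj; apply: functional_extensionality_dep => n.
  exact: xy.
have Kdyn (x : set_type K) : ((fun n => dyn (set_val x n)) : T) \in K.
  apply/mem_set => n; have xn : p n (set_val x n.+1) = set_val x n.
    exact: (set_valP x).
  by rewrite (factor_comm (fp n)) xn.
pose d (x : set_type K) : set_type K := 
  exist (fun y : T => y \in K) (fun n => dyn (set_val x n)) (Kdyn x).
have d_cont : continuous d.
  apply: (@continuous_separating _ _ _ (fun n => X n) pr) => //.
    by move=> n; exact: space_hausdorff.
  move=> n x; apply: (@continuous_comp _ _ _ (pr n) (@dyn (X n))).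
    exact: pr_cont.
  exact: dyn_continuous.
have pr_surj n (a : X n) : exists x, pr n x = a.
  have [x cx <-] := coherent_through a fp.
  by exists (exist _ x (mem_set cx)).
(* The cylinders of all the shifts, pulled back to the limit, form a countable separating family of
   clopen sets. *)
pose D (i : {n : nat & seq (alphabet (X n))}) :=
  pr (tag i) @^-1` (set_val @^-1` cylinder (tagged i)).
have [||B [cB clB bB]] := @clopen_separating_basis (set_type K) _ D cL.
- move=> i; apply: preimage_clopen; last exact: pr_cont.
  by apply: shift_cylinders_clopen; exists (tagged i).
- move=> x y xy; apply: pr_inj => n; apply: coord_inj => i.
  have := xy (Tagged (fun n => seq (alphabet (X n)))
    (mkseq (coord (pr n x)) i.+1)).
  rewrite /D /= => /(_ (mem_cylinder _ _)) /cylinderP /(_ i (ltnSn i)) yx.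
  exact/esym.
have hL : hausdorff_space (set_type K).
  move=> x y cl; apply: pr_inj => n; apply: (space_hausdorff (d := X n)).
  move=> A A' xA yA'.
  have [z [Az A'z]] := cl _ _ (pr_cont n x A xA) (pr_cont n y A' yA').
  by exists (pr n z).
have L0 : [set: set_type K] !=set0.
  have [a _] := space_nonempty (X 0).
  by have [x _] := pr_surj 0 a; exists x.
exists (DetSys d_cont (ex_intro2 _ _ B clB bB) (ex_intro2 _ _ B cB bB)
  cL hL L0).
by exists pr; split=> // x n; exact: (set_valP x).
Qed.

Lemma limit_map (M L : detSys) (X : nat -> shift_space)
    (p : forall n, X n.+1 -> X n) (psi : forall n, L -> X n)
    (d : forall n, M -> X n) :
  presents p psi -> (forall n, is_factor (d n)) ->
  (forall m, coherent p (fun n => d n m)) ->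
  exists2 h : M -> L, is_factor h & forall n m, psi n (h m) = d n m.
Proof.
move=> [fp fpsi cpsi sep] fd cd.
have down (u : L) m n : psi n.+1 u = d n.+1 m -> psi n u = d n m.
  by move=> um; rewrite -(cpsi u n) /= um; exact: (cd m n).
have hP m : exists u, forall n, psi n u = d n m.
  apply: (@compact_decreasing _ (fun n => [set u | psi n u = d n m])).
  - exact: space_compact.
  - move=> n; apply: closed_equalizer.
    + exact: (factor_continuous (fpsi n)).
    + exact: cst_continuous.
    + exact: space_hausdorff.
  - by move=> n u /=; exact: down.
  - by move=> n; exact: (factor_surj (fpsi n)).
have [h hE] := choice hP.
exists h => [|n m]; last exact: hE.
split=> [|u|m].
- apply: (@continuous_separating _ _ _ (fun n => X n) psi) => //.
  + exact: space_compact.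
  + by move=> n; exact: space_hausdorff.
  + by move=> n; exact: (factor_continuous (fpsi n)).
  + move=> n; rewrite (_ : psi n \o h = d n); last first.
      by apply/funext => m; exact: hE.
    exact: (factor_continuous (fd n)).
(* Surjectivity: the fibres of [d n] over [psi n u] decrease, and a common point is sent to [u]. *)
- have [|||n|m mE] :=
    @compact_decreasing _ (fun n => [set m | d n m = psi n u]).
  + exact: space_compact.
  + move=> n; apply: closed_equalizer.
    * exact: (factor_continuous (fd n)).
    * exact: cst_continuous.
    * exact: space_hausdorff.
  + by move=> n m mu; apply/esym/down/esym.
  + exact: (factor_surj (fd n)).
  + by exists m; apply: sep => n; rewrite hE; exact: mE.
- apply: sep => n.
  by rewrite hE (factor_comm (fpsi n)) hE (factor_comm (fd n)).
Qed.

(** * Colimits of ef-pairs as inverse limits of factors *)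

Definition ef_of (X Y : detSys) (f : Y -> X) (fP : is_factor f) :
    @hom detSys_ef X Y :=
  @EfPair X Y (fun x => f @^-1` [set x]) f fP (fun=> erefl).

Definition presented (S : shift_space -> Prop) (L : detSys) : Prop :=
  exists (X : nat -> shift_space) (p : forall n, X n.+1 -> X n)
    (psi : forall n, L -> X n), (forall n, S (X n)) /\ presents p psi.

Lemma presented_DS (S : shift_space -> Prop) (L : detSys) :
  presented S L -> DS S L.
Proof.
move=> [X [p [psi [SX pres]]]]; have [fp fpsi cpsi sep] := pres.
exists (fun n => shift_sys (X n) : detSys_ef), (fun n => ef_of (fp n)),
  (fun n => ef_of (fpsi n)); split=> [n|]; first by exists (X n).
split=> [n|M d cd].
  by apply: efPair_eq; apply/funext => u; exact: cpsi.
have [m n|h fh hE] := limit_map pres (fun n => ef_facP (d n)).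
  by have := congr1 (fun e => ef_fac e m) (cd n).
exists (ef_of fh); split=> [n|h' h'E].
  by apply: efPair_eq; apply/funext => m; exact: hE.
apply: efPair_eq; apply/funext => m; apply: sep => n.
by rewrite [LHS]hE -(h'E n).
Qed.

(* The true inverse limit factors onto the colimit [L] compatibly with the
   projections, so these already separate points of [L]. *)
Lemma DS_presented (S : shift_space -> Prop) (L : detSys) :
  DS S L -> presented S L.
Proof.
move=> [X0 [phi [c [SX [cc univ]]]]].
have [X XP] := choice SX.
have X0E : X0 = fun n => shift_sys (X n) by apply/funext => n; have [] := XP n.
subst X0.
have fp n : is_factor (ef_fac (phi n)) := ef_facP (phi n).
have [M [d dpres]] := inverse_limit fp; have [_ fd cd sepd] := dpres.
exists X, (fun n => ef_fac (phi n)), (fun n => ef_fac (c n)).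
split=> [n|]; first by have [] := XP n.
have cE u : coherent (fun n => ef_fac (phi n)) (fun n => ef_fac (c n) u).
  by move=> n; have := congr1 (fun e => ef_fac e u) (cc n).
split=> // [n|u v uv]; first exact: ef_facP (c n).
have [|h [hE _]] := univ M (fun n => ef_of (fd n)).
  by move=> n; apply: efPair_eq; apply/funext => m; exact: cd.
have hc m n : ef_fac (c n) (ef_fac h m) = d n m.
  by have := congr1 (fun e => ef_fac e m) (hE n).
have [m mu] := factor_surj (ef_facP h) u.
have [m' mv] := factor_surj (ef_facP h) v.
rewrite -mu -mv; congr (ef_fac h _); apply: sepd => n.
by rewrite -!hc mu mv.
Qed.

(** By [compact_uniform] some projection determines coordinate 0 of [g]; by equivariance it
    determines all of [g], which descends to a continuous [q]. *)
Lemma factor_through (L : detSys) (X : nat -> shift_space)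
    (p : forall n, X n.+1 -> X n) (psi : forall n, L -> X n)
    (Z : shift_space) (g : L -> Z) n0 :
  presents p psi -> is_factor g ->
  exists2 n, (n0 <= n)%N & exists2 q : X n -> Z, is_factor q &
    forall u, q (psi n u) = g u.
Proof.
move=> [fp fpsi cpsi sep] [cg sg eg].
have down n u v : psi n.+1 u = psi n.+1 v -> psi n u = psi n v.
  by move=> uv; rewrite -(cpsi u n) -(cpsi v n) /= uv.
(* The offset [n0] forces the stage found to lie at or beyond [n0]. *)
pose E n := [set z : L * L | psi (n0 + n) z.1 = psi (n0 + n) z.2].
have [|||||n nE] := @compact_uniform L _ (fun u => coord (g u) 0) E.
- exact: space_compact.
- move=> u; have : nbhs u (g @^-1` [set x | forall i, (i < 1)%N ->
    coord x i = coord (g u) i]) by exact: cg u _ (nbhs_coord (g u) 1).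
  by apply: filterS => v /= /(_ 0 isT).
- move=> n; apply: closed_equalizer.
  + by move=> z; apply: continuous_comp;
      [exact: cvg_fst | exact: (factor_continuous (fpsi _))].
  + by move=> z; apply: continuous_comp;
      [exact: cvg_snd | exact: (factor_continuous (fpsi _))].
  + exact: space_hausdorff.
- by move=> n [u v]; rewrite /E /= addnS; exact: down.
- move=> u v Euv; congr (coord (g _) 0); apply: sep => n.
  have := Euv n; rewrite /E /=; elim: n0 {E Euv} => // k IHk.
  by rewrite addSn => /down.
have it k u : psi (n0 + n) (iter k (@dyn L) u) =
    iter k (@dyn (X (n0 + n))) (psi (n0 + n) u).
  by elim: k => //= k <-; rewrite (factor_comm (fpsi _)).
have gE u v : psi (n0 + n) u = psi (n0 + n) v -> g u = g v.
  move=> uv; apply: coord_inj => i; rewrite coord_factor// [RHS]coord_factor//.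
  by apply: nE; rewrite /E /= !it uv.
have qP x : exists z, forall u, psi (n0 + n) u = x -> g u = z.
  have [u <-] := factor_surj (fpsi (n0 + n)) x.
  by exists (g u) => v /gE.
have [q qE] := choice qP.
have qg u : q (psi (n0 + n) u) = g u by apply/esym; exact: qE.
exists (n0 + n); first exact: leq_addr.
exists q => //; split=> [|z|x].
- apply: continuous_quotient cg _ qg.
  + exact: space_compact.
  + exact: space_hausdorff.
  + exact: (factor_continuous (fpsi _)).
  + exact: (factor_surj (fpsi _)).
- by have [u <-] := sg z; exists (psi (n0 + n) u).
- have [u <-] := factor_surj (fpsi (n0 + n)) x.
  by rewrite -(factor_comm (fpsi _)) !qg eg.
Qed.

(** Read through ef-pairs: an embedding of [X] into [U] extends along any embedding of [X] into [Y],
    the extension property of Fraïssé limits. *)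
Definition extensible (S : shift_space -> Prop) (U : detSys) : Prop :=
  forall (X Y : shift_space) (u : U -> X) (p : Y -> X), S X -> S Y ->
    is_factor u -> is_factor p ->
    exists2 v : U -> Y, is_factor v & forall x, p (v x) = u x.

(** Universality gives some factor [U -> Y], as [Y] is the limit of a constant chain; homogeneity
    then corrects it by an automorphism of [U] to lie over [u]. *)
Lemma universal_homogeneous_extensible (S : shift_space -> Prop)
    (U : detSys_ef) :
  universal (DS S) U -> homogeneous (shift_objects S) U -> extensible S U.
Proof.
move=> univ homog X Y u p SX SY fu fp.
have [|v] := univ Y.
  apply: presented_DS; exists (fun=> Y), (fun=> idfun), (fun=> idfun).
  split=> //; split=> // [_|_|x y /(_ 0)//]; exact: is_factor_id.
have fpv := is_factor_comp fp (ef_facP v).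
have [|h [_ hE]] := homog X _ (ef_of fu) (ef_of fpv); first by exists X.
exists (ef_fac v \o ef_fac h) => [|x].
  exact: is_factor_comp (ef_facP v) (ef_facP h).
by have := congr1 (fun e => ef_fac e x) hE.
Qed.

(** * Back-and-forth *)

(** A common quotient in [S], serving as an approximation to an isomorphism of [U] and [V]. *)
Record span (S : shift_space -> Prop) (U V : detSys) := Span {
  span_shift : shift_space;
  span_in : S span_shift;
  span_left : U -> span_shift;
  span_right : V -> span_shift;
  span_leftP : is_factor span_left;
  span_rightP : is_factor span_right }.

Definition refines (S : shift_space -> Prop) (U V : detSys) (a b : span S U V)
    (q : span_shift b -> span_shift a) : Prop :=
  [/\ is_factor q, forall u, q (span_left b u) = span_left a u &
      forall v, q (span_right b v) = span_right a v].

(** The left leg passes through some [X m] with [m >= n], which becomes the new span; the right leg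
    lifts to it since [V] is extensible. *)
Lemma refine_left (S : shift_space -> Prop) (U V : detSys)
    (X : nat -> shift_space) (p : forall n, X n.+1 -> X n)
    (psi : forall n, U -> X n) n (a : span S U V) :
  (forall n, S (X n)) -> presents p psi -> extensible S V ->
  exists b, exists2 q, @refines S U V a b q &
    forall u u', span_left b u = span_left b u' -> psi n u = psi n u'.
Proof.
move=> SX pres extV; have [_ fpsi cpsi _] := pres.
have [m lenm [q fq qE]] := factor_through n pres (span_leftP a).
have [v fv vE] := extV _ _ _ _ (span_in a) (SX m) (span_rightP a) fq.
exists (Span (SX m) (fpsi m) fv), q => // u u' /=.
elim: m lenm {q fq qE v fv vE} => [|m IHm]; first by rewrite leqn0 => /eqP->.
rewrite leq_eqVlt => /predU1P[->//|/IHm{}IHm uu']; apply: IHm.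
by rewrite -(cpsi u m) -(cpsi u' m) /= uu'.
Qed.

Definition span_flip (S : shift_space -> Prop) (U V : detSys) (a : span S U V) :
    span S V U :=
  Span (span_in a) (span_rightP a) (span_leftP a).

Lemma back_and_forth (S : shift_space -> Prop) (U V : detSys) (X : shift_space)
    (f : U -> X) (g : V -> X) :
  presented S U -> presented S V -> extensible S U -> extensible S V ->
  S X -> is_factor f -> is_factor g ->
  exists (h : U -> V) (k : V -> U),
    [/\ is_factor h, is_factor k, cancel h k, cancel k h &
        forall u, g (h u) = f u].
Proof.
move=> [XU [pU [psi [SU presU]]]] [XV [pV [chi [SV presV]]]] extU extV SX ff fg.
have step n (a : span S U V) : exists b, exists q, [/\ @refines S U V a b q,
    forall u u', span_left b u = span_left b u' -> psi n u = psi n u' &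
    forall v v', span_right b v = span_right b v' -> chi n v = chi n v'].
  have [b [q [fq ql qr] bsep]] := refine_left n a SU presU extV.
  have [c [r [fr rl rr] csep]] := refine_left n (span_flip b) SV presV extU.
  exists (span_flip c), (q \o r); split=> //.
    split=> [|u|v]; first exact: is_factor_comp.
      by rewrite /= -ql; congr q; exact: rr.
    by rewrite /= -qr; congr q; exact: rl.
  move=> u u' uu'; apply: bsep.
  have ru w : r (span_right c w) = span_left b w by exact: rr.
  by rewrite -!ru; congr r.
pose next n a := projT1 (cid (step n a)).
(* Starting from the span of [f] and [g] makes the isomorphism lie over [X]. The left and the right
   legs will present [U] and [V] as limits of the same sequence. *)
pose s := fix s n := if n is m.+1 then next m (s m) else Span SX ff fg.
pose q n : span_shift (s n.+1) -> span_shift (s n) :=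
  projT1 (cid (projT2 (cid (step n (s n))))).
have qP n : [/\ refines (q n),
    forall u u', span_left (s n.+1) u = span_left (s n.+1) u' ->
      psi n u = psi n u' &
    forall v v', span_right (s n.+1) v = span_right (s n.+1) v' ->
      chi n v = chi n v'].
  exact: (projT2 (cid (projT2 (cid (step n (s n)))))).
have presl : presents q (fun n => @span_left _ _ _ (s n)).
  split=> [n|n|u n|u u' uu'].
  - by have [[]] := qP n.
  - exact: span_leftP.
  - by have [[_ + _] _ _] := qP n; apply.
  - have [_ _ _ sep] := presU; apply: sep => n.
    by have [_ + _] := qP n; apply; exact: uu'.
have presr : presents q (fun n => @span_right _ _ _ (s n)).
  split=> [n|n|v n|v v' vv'].
  - by have [[]] := qP n.
  - exact: span_rightP.
  - by have [[_ _ +] _ _] := qP n; apply.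
  - have [_ _ _ sep] := presV; apply: sep => n.
    by have [_ _ +] := qP n; apply; exact: vv'.
have [fq fl cl sepl] := presl; have [_ fr cr sepr] := presr.
have [h fh hE] := limit_map presr fl cl.
have [k fk kE] := limit_map presl fr cr.
exists h, k; split=> // [u|v|u].
- by apply: sepl => n; rewrite kE hE.
- by apply: sepr => n; rewrite hE kE.
- exact: (hE 0 u).
Qed.

(** Starting over the one-point shift, factors onto the stages of [V] are lifted one link at a
    time. *)
Lemma extensible_factor (S : shift_space -> Prop) (U V : detSys) :
  S point_shift -> extensible S U -> presented S V ->
  exists h : U -> V, is_factor h.
Proof.
move=> Spt ext [X [p [psi [SX pres]]]]; have [fp _ _ _] := pres.
have [v0 fv0] : exists v : U -> X 0, is_factor v.
  have [t ft] := point_shift_terminal U.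
  have [t' ft'] := point_shift_terminal (X 0).
  by have [v fv _] := ext _ _ _ _ Spt (SX 0) ft ft'; exists v.
have step n (v : {v : U -> X n | is_factor v}) :
    exists w : {v : U -> X n.+1 | is_factor v},
      forall u, p n (sval w u) = sval v u.
  have [w fw wE] := ext _ _ _ _ (SX n) (SX n.+1) (svalP v) (fp n).
  by exists (exist _ w fw).
pose v := nat_rect (fun n => {v : U -> X n | is_factor v}) (exist _ v0 fv0)
  (fun n v => projT1 (cid (step n v))).
have [|u n|h fh _] := @limit_map U V X p psi (fun n => sval (v n)) pres.
- by move=> n; exact: svalP (v n).
- exact: (projT2 (cid (step n (v n)))).
- by exists h.
Qed.

(** Homogeneity is back-and-forth between [U] and itself over the given shift; uniqueness is
    back-and-forth over the one-point shift. *)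
Lemma extensible_unique (S : shift_space -> Prop) (U : detSys_ef) :
  S point_shift -> presented S U -> extensible S U ->
  unique_up_to_iso (fun V : detSys_ef =>
    DS S V /\ universal (DS S) V /\ homogeneous (shift_objects S) V) U.
Proof.
move=> Spt presU extU; split=> [|V [/DS_presented presV [univ homog]]].
  split; [exact: presented_DS | split] => [A /DS_presented presA|].
    by have [h fh] := extensible_factor Spt extU presA; split; exact: ef_of fh.
  move=> A [X [SX AX]] f g; subst A.
  have [h [k [fh fk hk kh gh]]] := back_and_forth presU presU extU extU SX
    (ef_facP f) (ef_facP g).
  exists (ef_of fh); split; last by apply: efPair_eq; apply/funext.
  by exists (ef_of fk); split; apply: efPair_eq; apply/funext.
have extV := universal_homogeneous_extensible univ homog.
have [t ft] := point_shift_terminal U.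
have [t' ft'] := point_shift_terminal V.
have [h [k [fh fk hk kh _]]] := back_and_forth presU presV extU extV Spt ft ft'.
by exists (ef_of fh), (ef_of fk); split; apply: efPair_eq; apply/funext.
Qed.

(** * The common universal homogeneous system *)

Lemma SFT_SOF (X : shift_space) : SFT X -> SOF X.
Proof.
by move=> sX; exists X; split=> //; exists idfun; exact: is_factor_id.
Qed.

Lemma fraisse_limit :
  exists U : detSys, presented SFT U /\ extensible SOF U.
Proof.
have fl n : is_factor (@link n) := ext_factor _.
have [U [psi pres]] := inverse_limit fl.
have presU : presented SFT U.
  exists (fun n => stage_shift (stages n)), link, psi.
  by split=> // n; exact: stage_sft.
exists U; split=> // X Y u p _ [Y' [sY' [r fr]]] fu fp.
have [n _ [q fq qE]] := factor_through 0 pres fu.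
(* The base [X] may be any shift here, while both sides have finite type: a stage through which [u]
   passes, and the cover [Y'] of [Y]. *)
have [W [sW [a [b [fa fb ab]]]]] :=
  SFT_pullback (stage_sft (stages n)) sY' fq (is_factor_comp fp fr).
have [m [s fs sE]] := stages_absorb (SFTExt sW fa).
have [_ fpsi cpsi _] := pres.
exists (r \o b \o s \o psi m) => [|x].
  by do 3!apply: is_factor_comp => //.
by rewrite -qE -(sE _ (cpsi x)) /= ab.
Qed.

Theorem theorem4p4 :
  exists U : detSys_ef,
    unique_up_to_iso (fun V : detSys_ef =>
      DS SFT V /\ universal (DS SFT) V /\ homogeneous (shift_objects SFT) V) U
    /\
    unique_up_to_iso (fun V : detSys_ef =>
      DS SOF V /\ universal (DS SOF) V /\ homogeneous (shift_objects SOF) V) U.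
Proof.
(* Each property of [U] is the stronger one: lifting for sofic shifts restricts to finite type, and
   a presentation by shifts of finite type is one by sofic shifts. *)
have [U [presU extU]] := fraisse_limit; exists U; split.
  apply: extensible_unique => //; first exact: point_shift_SFT.
  by move=> X Y u p /SFT_SOF SX /SFT_SOF SY; exact: extU.
apply: extensible_unique => //; first exact/SFT_SOF/point_shift_SFT.
have [X [p [psi [SX pres]]]] := presU.
by exists X, p, psi; split=> // n; exact: SFT_SOF.
Qed.
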